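(* Let $p$ be a prime, let $\mathcal F$ be a saturated fusion system on a finite $p$-group $S$, and let $P$ be a strongly $\mathcal F$-closed subgroup of $S$. Then $P\unlhd\mathcal F$ if and only if $\Omega^*(P)$ has a subgroup series $1=Q_0\le Q_1\le Q_2\le\cdots\le Q_{n-1}\le Q_n=\Omega^*(P)$ such that (a) $Q_i$ is strongly $\mathcal F$-closed for $i=0,1,\ldots,n$; (b) $[Q_{i+1},P]\le Q_i$ for $i=0,1,\ldots,n-1$.
   Context: All groups are finite and maps are written on the right. Fusion systems and saturated fusion systems on finite $p$-groups are understood in the standard sense. A subgroup $Q\le S$ is strongly $\mathcal F$-closed if for all $x\in Q$ and all $\phi\in\mathrm{Hom}_{\mathcal F}(\langle x\rangle,S)$ one has $x\phi\in Q$. $P\unlhd\mathcal F$ means $\mathcal F=N_{\mathcal F}(P)$, i.e. $P\unlhd S$ and every morphism $\phi:A\to B$ in $\mathcal F$ extends to a morphism $\overline\phi: PA\to PB$ in $\mathcal F$ with $P\overline\phi=P$. Let $\Gamma$ be the nontrivial semidirect product of $\mathbb Z_4$ by $\mathbb Z_4$. A $p$-group $P$ is of odd type if $P$ has no subgroup isomorphic to $Q_8$ and no subgroup isomorphic to $\Gamma$ (so $P$ is always of odd type when $p$ is odd). For $i\ge1$, $\Omega_i(P)=\langle x\in P\mid x^{p^i}=1\rangle$, and $\Omega(P)=\Omega_1(P)$. Define $\Omega^*(P)=\Omega(P)$ if $P$ is of odd type and $\Omega^*(P)=\Omega_2(P)$ otherwise. *)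

(* Defs.v *)
From HB Require Import structures.
From mathcomp Require Import all_boot all_fingroup all_solvable.

Set Implicit Arguments.
Unset Strict Implicit.
Unset Printing Implicit Defensive.

Local Open Scope group_scope.

(* The morphisms A -> B of a fusion system are represented by functions       *)
(* gT -> gT of which only the values on A matter (see fhom_ext); in this      *)
(* encoding id is the inclusion of A in B, and the restriction of a morphism  *)
(* to a subgroup of its source is the same function.                          *)
Record fusion_system (gT : finGroupType) (S : {group gT}) := FusionSystem {
  fhom : {group gT} -> {group gT} -> pred (gT -> gT);
  fhom_obj : forall A B f, fhom A B f -> A \subset S /\ B \subset S;
  fhom_inj : forall A B f, fhom A B f ->
    [/\ {in A &, {morph f : x y / x * y}}, {in A &, injective f}
      & f @: A \subset B];
  fhom_ext : forall (A B : {group gT}) f g,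
    {in A, f =1 g} -> fhom A B f -> fhom A B g;
  fhom_comp : forall A B C f g,
    fhom A B f -> fhom B C g -> fhom A C (g \o f);
  fhom_conj : forall (A B : {group gT}) s,
    A \subset S -> B \subset S -> s \in S -> A :^ s \subset B ->
    fhom A B (conjg^~ s);
  (* f : A -> B is an isomorphism A -> C of the category followed by the      *)
  (* inclusion of the image C in B.                                           *)
  fhom_factor : forall (A B C : {group gT}) f,
    fhom A B f -> f @: A = C ->
    fhom A C f /\ exists2 g, fhom C A g & {in A, cancel f g}
}.

Section FusionSystems.

Variables (gT : finGroupType) (S : {group gT}) (F : fusion_system S).

Definition fiso (A B : {group gT}) (f : gT -> gT) : bool :=
  fhom F A B f && (f @: A == B).

Definition fconj (A B : {group gT}) : Prop := exists f, fiso A B f.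

Definition fully_normalized (A : {group gT}) : Prop :=
  forall B, fconj A B -> #|'N_S(B)| <= #|'N_S(A)|.

Definition fully_centralized (A : {group gT}) : Prop :=
  forall B, fconj A B -> #|'C_S(B)| <= #|'C_S(A)|.

(* Elements of Aut A are permutations of gT fixing all x \notin A. *)
Definition AutF (A : {group gT}) : {set {perm gT}} :=
  [set a in Aut A | fhom F A A a].

Definition AutS (A : {group gT}) : {set {perm gT}} :=
  conj_aut A @* 'N_S(A).

Definition fully_automized (p : nat) (A : {group gT}) : Prop :=
  p.-Sylow(AutF A) (AutS A).

(* N_f: the g in N_S(A) such that f^-1 c_g f is conjugation on B by some      *)
(* element of N_S(B), for an isomorphism f : A -> B.                          *)
Definition extender (A B : {group gT}) (f : gT -> gT) : {set gT} :=
  [set g in 'N_S(A) |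
    [exists h in 'N_S(B), [forall x in A, f (x ^ g) == f x ^ h]]].

Lemma group_set_extender (A B : {group gT}) f :
  group_set (extender A B f).
Proof.
apply/group_setP; split=> [|g1 g2].
  rewrite inE group1; apply/exists_inP; exists 1; rewrite ?group1 //.
  by apply/forall_inP=> x _; rewrite !conjg1.
rewrite inE => /andP[Ng1 /exists_inP[h1 Nh1 /forall_inP E1]].
rewrite inE => /andP[Ng2 /exists_inP[h2 Nh2 /forall_inP E2]].
rewrite inE groupM //=; apply/exists_inP; exists (h1 * h2).
  by rewrite groupM.
apply/forall_inP=> x Ax; rewrite !conjgM.
have Axg: x ^ g1 \in A by rewrite memJ_norm //; case/setIP: Ng1.
by rewrite (eqP (E2 _ Axg)) (eqP (E1 _ Ax)).
Qed.

Canonical extender_group A B f := Group (group_set_extender A B f).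

(* Saturation in the sense of Broto, Levi and Oliver. *)
Definition saturated (p : nat) : Prop :=
  (forall A : {group gT}, A \subset S -> fully_normalized A ->
     fully_centralized A /\ fully_automized p A) /\
  (forall (A B : {group gT}) f, fiso A B f -> fully_centralized B ->
     exists2 g, fhom F (extender_group A B f) S g & {in A, g =1 f}).

Definition strongly_closed (Q : {group gT}) : Prop :=
  Q \subset S /\
  forall x f, x \in Q -> fhom F <[x]>%G S f -> f x \in Q.

(* As P is normal in S, the join P <*> A is the product P * A. *)
Definition fusion_normal (P : {group gT}) : Prop :=
  P <| S /\
  forall (A B : {group gT}) f, fhom F A B f ->
    exists g, [/\ fhom F (P <*> A)%G (P <*> B)%G g, {in A, g =1 f}
                & g @: P = P].

End FusionSystems.

(* Extremal.gtype 4 4 3 is the semidirect product of <[x]> by <[y]>, both     *)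
(* cyclic of order 4, with x ^ y = x ^+ 3 = x^-1. Inversion is the only       *)
(* nontrivial automorphism of Z_4, so there is no other nontrivial            *)
(* semidirect product of Z_4 by Z_4.                                          *)
Definition Gamma : finGroupType := Extremal.gtype 4 4 3.

Lemma card_Gamma : #|[set: Gamma]| = 16.
Proof. exact: Extremal.card. Qed.

Lemma Grp_Gamma :
  [set: Gamma] \isog Grp (x : y : x ^+ 4, y ^+ 4, x ^ y = x^-1).
Proof. exact: Grp_ext_dihedral. Qed.

Definition odd_type (gT : finGroupType) (P : {group gT}) : bool :=
  ~~ [exists H : {group gT}, (H \subset P) && (H \isog 'Q_8)] &&
  ~~ [exists H : {group gT}, (H \subset P) && (H \isog [set: Gamma])].

(* 'Ohm_i(P) is generated by the x in P with x ^+ (q ^ i) = 1, where q is the *)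
(* least prime divisor of #[x], so that q = p if P is a p-group and x != 1.   *)
Definition OhmStar (gT : finGroupType) (P : {group gT}) : {group gT} :=
  if odd_type P then 'Ohm_1(P)%G else 'Ohm_2(P)%G.

(* Main.v *)
(* If P is normal in F, every characteristic subgroup of P is strongly        *)
(* closed, and the subgroups 'Z_i(P) :&: OhmStar P form the series.           *)
(* Conversely, every f : A -> S extends to P <*> A, by downward induction on  *)
(* #|A|: it suffices to extend to some larger group. Saturation reduces this  *)
(* to an automorphism a of a fully normalized B that does not contain P. The  *)
(* F-automorphisms of B stabilizing the chain formed by S, P and the Q_i form *)
(* a normal subgroup K of AutF B containing the action of 'N_P(B). An element *)
(* of K of prime order q != p acts trivially on each B :&: Q_i by coprime     *)
(* action, hence on B :&: OhmStar P, on B :&: P and on B. So K is a p-group,  *)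
(* K is contained in the Sylow subgroup AutS B, and the extender of a         *)
(* contains B * 'N_P(B), which is larger than B.                              *)
(* An automorphism f of p'-order of a subgroup D of P that is trivial on D    *)
(* :&: OhmStar P is trivial: on a critical subgroup of D, w = x^-1 * f x      *)
(* satisfies w^p = 1 for odd p and w^4 = 1 for p = 2; in the latter case      *)
(* either w is in OhmStar P, or P is of odd type and w, f w generate a group  *)
(* containing Q_8 or Gamma.                                                   *)
Require Import Defs.
From mathcomp Require Import all_boot all_fingroup all_solvable.

Set Implicit Arguments.
Unset Strict Implicit.
Unset Printing Implicit Defensive.

Local Open Scope group_scope.

(** If [P] is normal in [F], morphisms extend to maps preserving [P], so characteristic subgroups of
    [P] are strongly closed ([char_strongly_closed]), and the upper central series of [P] cut down
    to [OhmStar P] is a series as required.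

    Conversely, everything rests on a rigidity fact: a p'-automorphism of a subgroup of [P] that
    fixes its elements lying in [OhmStar P] is trivial ([fix_of_fix_OhmStar]). Hence the
    automorphisms in [AutF F B] that act trivially on the factors of the given series and on [B]
    modulo [P] form a normal p-subgroup, contained in [AutS S B] when the latter is Sylow
    ([series_stabilizer_sub_AutS]). Condition (b) puts conjugation by ['N_P(B)] into this subgroup,
    so saturation extends automorphisms of a fully normalized [B] beyond [B] as long as [B] does not
    contain [P] ([extender_proper]). Downward induction on the order of the source then reaches the
    join with [P] ([strongly_closed_extends]). *)

(** * Subgroups isomorphic to Q_8 or Gamma *)

Lemma order_eq4 (gT : finGroupType) (x : gT) :
  x ^+ 2 != 1 -> x ^+ 4 = 1 -> #[x] = 4.
Proof.
move=> x2 x4; apply: (@orderXprime _ 2 2 x) => //.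
apply: nt_prime_order => //; first by rewrite -expgM.
Qed.

Lemma order4_involution (gT : finGroupType) (x t : gT) :
  #[x] = 4 -> t \in <[x]> -> #[t] = 2 -> t = x ^+ 2.
Proof.
move=> ox /cyclePmin[i]; rewrite ox => lti4 ->.
case: i lti4 => [|[|[|[|//]]]] _ //.
- by rewrite order1.
- by rewrite expg1 ox.
- by rewrite orderXgcd ox.
Qed.

(** The relations make [<[x]> <*> <[y]>] an image of ['Q_8]. As [y] inverts [x], it lies outside
    [<[x]>], and an order above 4 and divisible by 4 is at least 8. *)
Lemma quaternion_not_odd_type (gT : finGroupType) (P : {group gT}) (x y : gT) :
    x \in P -> y \in P -> #[x] = 4 -> y ^+ 2 = x ^+ 2 -> x ^ y = x^-1 ->
  ~~ odd_type P.
Proof.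
move=> Px Py ox y2 xy; rewrite negb_and !negbK; apply/orP; left.
apply/existsP; exists (<[x]> <*> <[y]>)%G.
rewrite join_subG !cycle_subG Px Py /=.
have x2n1: x ^+ 2 != 1 by rewrite -order_dvdn ox.
have oQ: #|[set: 'Q_8]| = 8 by apply: (@card_quaternion 3).
rewrite isogEcard oQ (@Grp_quaternion 3) //; apply/andP; split.
  apply/existsP; exists (x, y).
  have x4: x ^+ (2 ^ 3.-1) = 1 by rewrite -[(2 ^ _)%N]ox expg_order.
  by rewrite /= !xpair_eqE x4 y2 xy !eqxx.
have sxH: <[x]> \subset <[x]> <*> <[y]> by rewrite joing_subl.
have: 4 < #|<[x]> <*> <[y]>|.
  rewrite -ox proper_card // properE sxH /= join_subG subxx cycle_subG /=.
  apply: contra x2n1 => /cycleP[i dy].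
  have: x ^ y = x by rewrite dy conjgE (commuteX i (commute_refl x)) mulKg.
  by rewrite xy expgS expg1 => {1}<-; rewrite mulVg.
have /dvdnP[k ->]: 4 %| #|<[x]> <*> <[y]>| by rewrite -ox; apply: cardSg.
by rewrite -{1}[4]mul1n ltn_pmul2r // -[8]/(2 * 4)%N leq_pmul2r.
Qed.

(** If the two cyclic groups met nontrivially, a common involution would be both [x ^+ 2] and
    [y ^+ 2]. So they generate a group of order 16 satisfying the relations of [Gamma]. *)
Lemma Gamma_not_odd_type (gT : finGroupType) (P : {group gT}) (x y : gT) :
    x \in P -> y \in P -> #[x] = 4 -> #[y] = 4 -> x ^+ 2 != y ^+ 2 ->
  x ^ y = x^-1 -> ~~ odd_type P.
Proof.
move=> Px Py ox oy neq xy; rewrite negb_and !negbK; apply/orP; right.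
apply/existsP; exists (<[x]> <*> <[y]>)%G.
rewrite join_subG !cycle_subG Px Py /=.
rewrite isogEcard card_Gamma Grp_Gamma; apply/andP; split.
  apply/existsP; exists (x, y); rewrite /= !xpair_eqE xy -{1}ox expg_order.
  by rewrite -oy expg_order !eqxx.
have tixy: <[x]> :&: <[y]> = 1.
  apply: contraNeq neq => ntI.
  have pI: 2.-group (<[x]> :&: <[y]>).
    by apply: (pgroupS (subsetIl _ _)); rewrite /pgroup -orderE ox.
  have [_ d2 _] := pgroup_pdiv pI ntI.
  have [//|t /setIP[tx ty] ot] := Cauchy _ d2.
  by rewrite -(order4_involution ox tx ot) -(order4_involution oy ty ot).
have defG: <[x]> <*> <[y]> = <[x]> * <[y]>.
  by rewrite norm_joinEr // norms_cycle xy groupV cycle_id.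
by rewrite /= defG TI_cardMg // -!orderE ox oy.
Qed.

(* For [z = x ^+ 2] the elements generate Q_8; otherwise [x * y] squares to   *)
(* [z], and [x] inverts it.                                                   *)
Lemma commutator_not_odd_type (gT : finGroupType) (P : {group gT})
    (x y z : gT) :
    x \in P -> y \in P -> #[x] = 4 -> y ^+ 2 = x ^+ 2 ->
    [~ x, y] = z -> z != 1 -> z ^+ 2 = 1 -> commute x z -> commute y z ->
  ~~ odd_type P.
Proof.
move=> Px Py ox y2 def_z ntz z2 cxz cyz.
have x4: x ^+ 4 = 1 by rewrite -ox expg_order.
have xy: x ^ y = x * z by rewrite -def_z commgEl mulKVg.
have [zx2 | nzx2] := eqVneq z (x ^+ 2).
  apply: (quaternion_not_odd_type Px Py ox y2).
  rewrite xy zx2 -expgS; apply/esym/eqP.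
  by rewrite eq_invg_mul -expgS x4.
have yx: y * x = x * y * z.
  by rewrite [x * y]commgC def_z -mulgA -expg2 z2 mulg1.
have w2: (x * y) ^+ 2 = z.
  rewrite expg2 -mulgA [y * (x * y)]mulgA yx -!mulgA -cyz !mulgA -expg2.
  by rewrite -[_ * y * y]mulgA -[y * y]expg2 y2 -expgD x4 mul1g.
have w4: (x * y) ^+ 4 = 1 by rewrite -[4]/(2 * 2)%N expgM w2.
have ow: #[x * y] = 4 by apply: order_eq4 w4; rewrite w2.
apply: (Gamma_not_odd_type (groupM Px Py) Px ow ox); first by rewrite w2.
rewrite conjgE -[x * y * x]mulgA mulKg yx -w2 -expgS; apply/esym/eqP.
by rewrite eq_invg_mul -expgS w4.
Qed.

(** * Coprime automorphisms and [OhmStar] *)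

(** With [y = x^-1 * f x] fixed, [iter k f x = x * y ^+ k], so [y ^+ k = 1] and coprimality kills
    [y]. This drives the coprime-action arguments below. *)
Lemma coprime_fix_of_fix_quotient (gT : finGroupType) (D : {group gT})
    (f : {morphism D >-> gT}) (k : nat) (x : gT) :
    coprime #|D| k -> x \in D -> f x \in D -> iter k f x = x ->
    f (x^-1 * f x) = x^-1 * f x ->
  f x = x.
Proof.
move=> co Dx Dfx fkx; set y := _^-1 * _ => fy.
have Dy: y \in D by rewrite groupM ?groupV.
have fx: f x = x * y by rewrite mulKVg.
have iterf j: iter j f x = x * y ^+ j.
  elim: j => [|j IHj]; first by rewrite mulg1.
  by rewrite iterS IHj morphM ?groupX // morphX // fy fx -mulgA -expgS.
have yk: y ^+ k = 1 by apply: (mulgI x); rewrite -iterf fkx mulg1.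
suff y1: y = 1 by rewrite fx y1 mulg1.
apply/eqP; rewrite -order_eq1 -dvdn1 -(eqP co) dvdn_gcd order_dvdG //=.
by rewrite order_dvdn yk.
Qed.

Lemma mem_OhmStar_exp (gT : finGroupType) (p : nat) (P : {group gT}) (x : gT) :
  p.-group P -> x \in P -> x ^+ p = 1 -> x \in OhmStar P.
Proof.
move=> pP Px xp.
have Ox: x \in 'Ohm_1(P).
  by rewrite (OhmE 1 pP) mem_gen // !inE Px expn1 xp eqxx.
by rewrite /OhmStar; case: ifP => // _; apply: (subsetP (Ohm_leq P _)) Ox.
Qed.

Lemma mem_OhmStar_exp4 (gT : finGroupType) (P : {group gT}) (x : gT) :
  2.-group P -> ~~ odd_type P -> x \in P -> x ^+ 4 = 1 -> x \in OhmStar P.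
Proof.
move=> pP nodd Px x4; rewrite /OhmStar (negbTE nodd) /= (OhmE 2 pP).
by rewrite mem_gen // !inE Px x4 eqxx.
Qed.

Section CoprimeAction.

Variables (gT : finGroupType) (p k : nat) (P D : {group gT}).
Variable f : {morphism D >-> gT}.
Hypotheses (p_pr : prime p) (pP : p.-group P) (sDP : D \subset P).
Hypotheses (injf : 'injm f) (fD : f @* D = D) (coDk : coprime #|D| k).
Hypothesis fk : {in D, forall x, iter k f x = x}.
Hypothesis fixO : {in D :&: OhmStar P, forall x, f x = x}.

Let Df x : x \in D -> f x \in D.
Proof. by move=> Dx; rewrite -{2}fD mem_morphim. Qed.

Let fix_commg x : x \in D -> f (x^-1 * f x) = x^-1 * f x -> f x = x.
Proof.
by move=> Dx; apply: (coprime_fix_of_fix_quotient coDk); rewrite ?Df ?fk.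
Qed.

Let pD : p.-group D := pgroupS sDP pP.

Lemma fix_of_exp x : x \in D -> x ^+ p = 1 -> f x = x.
Proof.
move=> Dx xp; apply: fixO; rewrite inE Dx.
by rewrite (mem_OhmStar_exp pP) // (subsetP sDP).
Qed.

(** Induction on [#[x]]: once [x ^+ p] is fixed, [x^-1 * f x] has trivial [p]-th power, hence is
    fixed too. *)
Lemma fix_abelian_char (Z : {group gT}) :
  Z \char D -> abelian Z -> {in Z, forall x, f x = x}.
Proof.
move=> /charP[sZD chZ] abZ x.
have fZ: f @* Z = Z by apply: chZ.
have [n] := ubnP #[x]; elim: n x => // n IHn x lexn Zx.
have Dx := subsetP sZD x Zx.
have Zfx: f x \in Z by rewrite -fZ mem_morphim.
have [-> | ntx] := eqVneq x 1; first by rewrite morph1.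
have fxp: f (x ^+ p) = x ^+ p.
  apply: IHn; last by rewrite groupX.
  have pdx: p %| #[x].
    have [|//] := pgroup_pdiv (mem_p_elt pD Dx : p.-group <[x]>).
    by rewrite cycle_eq1.
  by rewrite orderXdiv // (leq_trans (ltn_Pdiv _ _)) ?prime_gt1 ?order_gt0.
apply: fix_commg => //; apply: fix_of_exp; first by rewrite groupM ?groupV ?Df.
rewrite expgMn; last by apply: (centsP abZ); rewrite ?groupV.
by rewrite expgVn -morphX // fxp mulVg.
Qed.

(** In [C], commutators and [p]-th powers are central, and ['Z(C)] is already fixed. So
    [w = x^-1 * f x] satisfies [w ^+ p = 1] for odd [p], and [w ^+ 4 = 1] for [p = 2]. *)
Lemma fix_critical (C : {group gT}) :
  critical C D -> {in C, forall x, f x = x}.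
Proof.
move=> [chC sPhiZ _ _].
have sCD := char_sub chC.
have fC: f @* C = C by case/charP: chC => _ ->.
have pC := pgroupS sCD pD.
have fixZ: {in 'Z(C), forall x, f x = x}.
  by apply: fix_abelian_char; rewrite ?center_abelian ?(gFchar_trans _ chC).
have Cf x : x \in C -> f x \in C.
  by move=> Cx; rewrite -fC mem_morphim // (subsetP sCD).
have ZX x : x \in C -> x ^+ p \in 'Z(C).
  move=> Cx; apply: (subsetP sPhiZ); rewrite (Phi_joing pC).
  by apply: (subsetP (joing_subr _ _)); rewrite (Mho_p_elt 1) ?(mem_p_elt pC).
have ZR x y : x \in C -> y \in C -> [~ x, y] \in 'Z(C).
  move=> Cx Cy; apply: (subsetP sPhiZ); rewrite (Phi_joing pC).
  by apply: (subsetP (joing_subl _ _)); rewrite mem_commg.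
have cZ z y: z \in 'Z(C) -> y \in C -> commute y z.
  by case/centerP=> _ cz Cy; apply/commute_sym/cz.
have RX x y : x \in C -> y \in C -> [~ x, y] ^+ p = 1.
  move=> Cx Cy; rewrite -commXg; last exact: (cZ _ _ (ZR _ _ Cx Cy)).
  by apply/eqP/commgP/commute_sym/cZ; rewrite ?ZX.
(* The class 2 power formula; the factors [x ^- p] and [f x ^+ p = f (x ^+ p)] cancel because
   [x ^+ p] is fixed. *)
have quoX x : x \in C -> (x^-1 * f x) ^+ p = [~ f x, x^-1] ^+ 'C(p, 2).
  move=> Cx; have CVx: x^-1 \in C by rewrite groupV.
  have Zxf := ZR _ _ (Cf _ Cx) CVx.
  rewrite expMg_Rmul; try by apply: cZ; rewrite ?Cf.
  by rewrite expgVn -morphX ?(subsetP sCD) // fixZ ?ZX // mulVg mul1g.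
move=> x Cx; set w := x^-1 * f x.
have Cw: w \in C by rewrite groupM ?groupV ?Cf.
have Dw := subsetP sCD w Cw.
apply: fix_commg; rewrite ?(subsetP sCD) // -/w.
have [p2 | op] := even_prime p_pr; last first.
  apply: fix_of_exp => //; rewrite quoX // bin2odd // expgM.
  by rewrite RX ?expg1n ?Cf ?groupV.
have [w2 | ntw2] := eqVneq (w ^+ 2) 1.
  by apply: fix_of_exp; rewrite // p2.
have w4: w ^+ 4 = 1.
  have -> : w ^+ 4 = (w ^+ p) ^+ p by rewrite p2 -expgM.
  by rewrite quoX // -expgM mulnC expgM RX ?expg1n ?Cf ?groupV.
have [oddP | ] := boolP (odd_type P); last first.
  move=> nodd; apply: fixO; rewrite inE Dw.
  by rewrite mem_OhmStar_exp4 ?(subsetP sDP) // -p2.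
(* As [w ^+ 2] is fixed, [w] and [f w] have the same square. If they commute, [w^-1 * f w] has
   square 1, so [w] is fixed; otherwise they contradict odd type. *)
have [fz | ntz] := eqVneq [~ w, f w] 1.
  apply: fix_commg => //; apply: fix_of_exp.
    by rewrite groupM ?groupV ?Df.
  rewrite p2 -p2 quoX // p2 expg1; apply/eqP/commgP/commuteV/commute_sym.
  by apply/commgP; rewrite fz.
suff: ~~ odd_type P by rewrite oddP.
apply: (@commutator_not_odd_type _ _ w (f w) [~ w, f w]) => //.
- exact: (subsetP sDP).
- by rewrite (subsetP sDP) ?Df.
- exact: order_eq4.
- by rewrite -morphX // fixZ // -p2 ZX.
- by rewrite -p2 RX ?Cf.
- by apply: cZ; rewrite ?ZR ?Cf.
- by apply: cZ; rewrite ?ZR ?Cf.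
Qed.

(* Three subgroups: [f] centralizes the critical subgroup [C], so it moves    *)
(* each [x] in [D] by an element of ['C_D(C) = 'Z(C)].                        *)
Lemma fix_of_fix_OhmStar : {in D, forall x, f x = x}.
Proof.
have [C critC] := Thompson_critical pD.
have fixC := fix_critical critC.
have [chC _ _ cC] := critC.
have sCD := char_sub chC.
move=> x Dx; apply: fix_commg => //; apply: (fixC).
have Dy: x^-1 * f x \in D by rewrite groupM ?groupV ?Df.
apply: (subsetP (center_sub C)); rewrite -cC inE Dy.
apply/centP=> c Cc; apply/esym/commgP/conjg_fixP.
have nCD: D \subset 'N(C) := char_norm chC.
have Cd: c ^ x^-1 \in C by rewrite memJ_norm ?groupV // (subsetP nCD).
(* Both [c ^ x^-1] and [c] are fixed, so applying [f] to [(c ^ x^-1) ^ x = c] replaces [x] by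
   [f x]. *)
rewrite conjgM -{1}(fixC _ Cd) -(morphJ f (subsetP sCD _ Cd) Dx).
by rewrite conjgKV fixC.
Qed.

End CoprimeAction.

(** * Basic facts on fusion systems *)

Section FusionSystemTheory.

Variables (gT : finGroupType) (S : {group gT}) (F : fusion_system S).
Implicit Types (A B C Q : {group gT}) (f g : gT -> gT).

Lemma fhom_id A B : A \subset B -> B \subset S -> fhom F A B id.
Proof.
move=> sAB sBS; apply: (@fhom_ext _ _ F A B (conjg^~ 1)) => [x _|].
  by rewrite conjg1.
by apply: fhom_conj; rewrite ?conjsg1 ?(subset_trans sAB).
Qed.

Lemma fhom_sub A A' B B' f :
    fhom F A B f -> A' \subset A -> B \subset B' -> B' \subset S ->
  fhom F A' B' f.
Proof.
move=> hf sA sB sBS; have [sAS _] := fhom_obj hf.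
exact: fhom_comp (fhom_comp (fhom_id sA sAS) hf) (fhom_id sB sBS).
Qed.

Lemma fiso_image A B f : fhom F A B f -> exists C, fiso F A C f.
Proof.
move=> hf; have [fM _ _] := fhom_inj hf.
have fA: f @: A = (Morphism fM @* A)%G by rewrite /= morphimEdom.
by exists (Morphism fM @* A)%G; rewrite /fiso fA eqxx (fhom_factor hf fA).1.
Qed.

Lemma fhom_codom A B C f :
  fhom F A B f -> f @: A \subset C -> C \subset S -> fhom F A C f.
Proof.
move=> hf; have [D /andP[hD /eqP ->]] := fiso_image hf.
exact: fhom_sub hD (subxx A).
Qed.

Lemma fiso_sub A B f : fiso F A B f -> A \subset S /\ B \subset S.
Proof. by case/andP=> /fhom_obj. Qed.

Lemma fiso_card A B f : fiso F A B f -> #|B| = #|A|.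
Proof.
case/andP=> /fhom_inj[_ injf _] /eqP <-.
by rewrite card_in_imset.
Qed.

Lemma fiso_inv A B f :
  fiso F A B f -> exists2 g, fiso F B A g & {in A, cancel f g}.
Proof.
case/andP=> hf /eqP fA; have [_ [g hg fK]] := fhom_factor hf fA.
exists g => //; rewrite /fiso hg /= -fA -imset_comp; apply/eqP.
by rewrite -[RHS]imset_id; apply: eq_in_imset => x /fK.
Qed.

Lemma fiso_comp A B C f g :
  fiso F A B f -> fiso F B C g -> fiso F A C (g \o f).
Proof.
case/andP=> hf /eqP fA /andP[hg /eqP gB]; rewrite /fiso (fhom_comp hf hg) /=.
by rewrite imset_comp fA gB.
Qed.

Lemma AutF_of_fhom A f :
  fhom F A A f -> exists2 a, a \in AutF F A & {in A, a =1 f}.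
Proof.
move=> hf; have [fM injf sfA] := fhom_inj hf.
pose a := perm_in injf sfA.
have aE: {in A, a =1 f} by move=> x Ax; rewrite /a perm_inE.
exists a => //; rewrite !inE perm_in_on /=; apply/andP; split.
  by apply/morphicP=> x y Ax Ay; rewrite !aE ?groupM ?fM.
by apply: fhom_ext hf => x Ax; rewrite aE.
Qed.

Lemma group_set_AutF A : A \subset S -> group_set (AutF F A).
Proof.
move=> sAS; apply/group_setP; split=> [|a b].
  rewrite inE group1; apply: fhom_ext (fhom_id (subxx A) sAS) => x _.
  by rewrite perm1.
case/setIdP=> Aa ha /setIdP[Ab hb]; rewrite inE groupM //=.
by apply: fhom_ext (fhom_comp ha hb) => x _; rewrite permM.
Qed.

Lemma AutF_fiso A a : a \in AutF F A -> fiso F A A a.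
Proof.
rewrite inE => /andP[Aa ha]; rewrite /fiso ha /=.
by have := im_autm Aa; rewrite morphimEdom => /eqP.
Qed.

Lemma conj_aut_AutF A s : A \subset S -> s \in 'N_S(A) ->
  conj_aut A s \in AutF F A.
Proof.
move=> sAS /setIP[Ss Ns]; rewrite inE Aut_aut /=.
have hs: fhom F A A (conjg^~ s) by apply: fhom_conj; rewrite ?(normP Ns).
by apply: fhom_ext hs => x Ax; rewrite norm_conj_autE.
Qed.

Lemma strongly_closed_fhom Q A B f x :
  strongly_closed F Q -> fhom F A B f -> x \in A -> x \in Q -> f x \in Q.
Proof.
move=> [_ clQ] hf Ax Qx; apply: clQ => //.
by apply: (fhom_sub hf); rewrite ?cycle_subG //; case: (fhom_obj hf).
Qed.

Lemma strongly_closed_normal Q : strongly_closed F Q -> Q <| S.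
Proof.
move=> clQ; have [sQS _] := clQ; rewrite /normal sQS.
apply/subsetP=> s Ss; rewrite inE; apply/subsetP=> _ /imsetP[x Qx ->].
have hs: fhom F Q S (conjg^~ s).
  by apply: fhom_conj; rewrite // -(conjGid Ss) conjSg.
exact: (strongly_closed_fhom clQ hs).
Qed.

Lemma strongly_closed_self : strongly_closed F S.
Proof.
split=> // x f Sx /fhom_inj[_ _ /subsetP sfS].
by apply: sfS; rewrite imset_f ?cycle_id.
Qed.

Lemma strongly_closed_im Q A B f :
  strongly_closed F Q -> fhom F A B f -> Q \subset A -> f @: Q = Q.
Proof.
move=> clQ hf sQA; have [_ injf _] := fhom_inj hf.
apply/eqP; rewrite eqEcard card_in_imset ?leqnn ?andbT.
  apply/subsetP=> _ /imsetP[x Qx ->].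
  by apply: (strongly_closed_fhom clQ hf) => //; apply: (subsetP sQA).
by apply: sub_in2 injf; apply/subsetP.
Qed.

Lemma ex_fully_normalized A : A \subset S ->
  exists2 B, fconj F A B & fully_normalized F B.
Proof.
(* Quantifying over finite functions makes conjugacy boolean, so a conjugate with largest normalizer
   can be picked. *)
move=> sAS; pose conjA B := [exists f : {ffun gT -> gT}, fiso F A B f].
have conjAP B : reflect (fconj F A B) (conjA B).
  apply: (iffP existsP) => [[f hf] | [f /andP[hf /eqP fA]]]; first by exists f.
  have fE: {in A, f =1 finfun f} by move=> x _; rewrite ffunE.
  exists (finfun f); rewrite /fiso (fhom_ext fE hf) /=.
  by rewrite -(eq_in_imset fE) fA.
have AA: conjA A.
  by apply/conjAP; exists id; rewrite /fiso fhom_id //= imset_id.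
have [B /conjAP[f hf] maxB] := arg_maxnP (fun B : {group gT} => #|'N_S(B)|) AA.
exists B; first by exists f.
move=> C [g hg]; apply: maxB; apply/conjAP.
by exists (g \o f); apply: fiso_comp hg.
Qed.

End FusionSystemTheory.

(** * Automizers and stabilizers of series *)

Lemma pgroup_of_prime_order (gT : finGroupType) (p : nat) (G : {group gT}) :
  (forall x, x \in G -> prime #[x] -> #[x] = p) -> p.-group G.
Proof.
move=> orderG; apply/pgroupP=> q q_pr qG.
by have [x Gx ox] := Cauchy q_pr qG; rewrite inE -ox orderG ?ox.
Qed.

Section Saturation.

Variables (gT : finGroupType) (S : {group gT}) (F : fusion_system S).
Variable p : nat.
Hypothesis pS : p.-group S.
Implicit Types (A B Q : {group gT}) (f : gT -> gT).

(* By Sylow, an automorphism of [B] moves the [f]-transport of [Aut_S(A)]     *)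
(* into [Aut_S(B)].                                                           *)
Lemma fully_automized_twist A B f :
    fiso F A B f -> fully_automized F p B ->
  exists2 a, a \in AutF F B & 'N_S(A) \subset extender S A B (a \o f).
Proof.
move=> isof autB; have [sAS sBS] := fiso_sub isof.
have [hf /eqP fA] := andP isof.
have Bf x : x \in A -> f x \in B by move=> Ax; rewrite -fA imset_f.
have AJ s x : s \in 'N_S(A) -> x \in A -> x ^ s \in A.
  by case/setIP=> _ Ns Ax; rewrite memJ_norm.
(* [D] is the transport along [f] of [AutS S A]. *)
pose D := [set a in AutF F B |
  [exists s in 'N_S(A), [forall x in A, a (f x) == f (x ^ s)]]].
have DP a : a \in D -> a \in AutF F B /\
    exists2 s, s \in 'N_S(A) & {in A, forall x, a (f x) = f (x ^ s)}.
  case/setIdP=> Fa /exists_inP[s Ns /forall_inP E]; split=> //.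
  by exists s => // x /E/eqP.
have gAut := group_set_AutF F sBS.
have gD : group_set D.
  apply/group_setP; split=> [|a b /DP[Fa [s Ns Ea]] /DP[Fb [t Nt Eb]]].
    rewrite inE; have [-> _] := group_setP gAut.
    apply/exists_inP; exists 1; rewrite ?group1 //.
    by apply/forall_inP=> x _; rewrite perm1 conjg1.
  rewrite inE; have [_ ->] := group_setP gAut => //.
  apply/exists_inP; exists (s * t); rewrite ?groupM //.
  by apply/forall_inP=> x Ax; rewrite permM Ea ?Eb ?AJ // conjgM.
have pD : p.-group (Group gD).
  apply: pgroup_of_prime_order => a Da q_pr.
  have [/setIdP[Ba _] [s Ns Ea]] := DP _ Da.
  have iterE j x : x \in A -> (a ^+ j) (f x) = f (x ^ (s ^+ j)).
    elim: j x => [|j IHj] x Ax; first by rewrite perm1 conjg1.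
    by rewrite expgSr permM IHj // Ea ?AJ ?groupX // -conjgM -expgSr.
  (* Powers of [a] correspond to powers of [s], so [#[a]] divides [#[s]], a power of [p]. *)
  have as1: a ^+ #[s] = 1.
    apply: (eq_Aut (groupX _ Ba) (group1 _)) => y; rewrite -fA.
    by case/imsetP=> x Ax ->; rewrite iterE // expg_order conjg1 perm1.
  have p_s: p.-elt s by apply: mem_p_elt pS _; case/setIP: Ns.
  have: p.-nat #[a] by apply: pnat_dvd p_s; rewrite order_dvdn as1.
  by rewrite pnatE // => /eqP.
have sDF : Group gD \subset Group gAut by apply/subsetP=> a /DP[].
have [b Fb sDb] := @Sylow_subJ p _ (Group gAut) (conj_aut B @* 'N_S(B))%G
  (Group gD) autB sDF pD.
(* [D] lies in the conjugate of [AutS S B] by [b], so following [f] by [b^-1] moves the transport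
   into [AutS S B]. *)
have Fa : b^-1 \in Group gAut by rewrite groupV.
exists b^-1 => //; apply/subsetP=> s Ns; rewrite inE Ns /=.
have [d Dd Ed] : exists2 d, d \in D & {in A, forall x, d (f x) = f (x ^ s)}.
  have [g isog fK] := fiso_inv isof.
  have hs : fhom F A A (conjg^~ s).
    by case/setIP: Ns => Ss Ns; apply: fhom_conj; rewrite ?(normP Ns).
  have [hg _] := andP isog.
  have [d Fd dE] := AutF_of_fhom (fhom_comp hg (fhom_comp hs hf)).
  have dfE : {in A, forall x, d (f x) = f (x ^ s)}.
    by move=> x Ax; rewrite dE ?Bf //= fK.
  exists d; rewrite // inE Fd; apply/exists_inP; exists s => //.
  by apply/forall_inP=> x Ax; rewrite dfE.
have /(subsetP sDb) : d \in Group gD := Dd.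
rewrite mem_conjg => /morphimP[t _ Nt dt].
apply/exists_inP; exists t => //; apply/forall_inP=> x Ax /=.
have Bbfx : b^-1 (f x) \in B.
  by case/setIdP: Fa => Ba _; apply: (Aut_closed Ba); rewrite Bf.
rewrite -Ed // -permM conjgC permM.
have : (d ^ b^-1) (b^-1 (f x)) = b^-1 (f x) ^ t.
  by rewrite dt norm_conj_autE //; case/setIP: Nt.
by move=> ->.
Qed.

Section SeriesStabilizer.

Variables (I : finType) (X Y : I -> {group gT}) (B : {group gT}).
Hypotheses (sBS : B \subset S).
Hypotheses (clX : forall i, strongly_closed F (X i)).
Hypotheses (clY : forall i, strongly_closed F (Y i)).

(** A chain enters as the family of its steps, from [Y i] up to [X i]. Strong closure of the [X i]
    makes this a group; with that of the [Y i] it is normal in [AutF F B]. *)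
Definition series_stabilizer : {set {perm gT}} :=
  [set a in AutF F B | [forall i, forall x in B :&: X i, x^-1 * a x \in Y i]].

Lemma series_stabilizerP a :
  reflect (a \in AutF F B /\
           forall i, {in B :&: X i, forall x, x^-1 * a x \in Y i})
          (a \in series_stabilizer).
Proof.
apply: (iffP setIdP) => [[Fa /forallP E] | [Fa E]]; split=> //.
  by move=> i x XBx; have /forall_inP-> := E i.
by apply/forallP=> i; apply/forall_inP=> x; apply: E.
Qed.

Lemma AutF_mem a x Q :
  a \in AutF F B -> strongly_closed F Q -> x \in B :&: Q -> a x \in B :&: Q.
Proof.
move=> /setIdP[Ba ha] clQ /setIP[Bx Qx]; rewrite inE (Aut_closed Ba Bx).
exact: strongly_closed_fhom ha Bx Qx.
Qed.

Lemma group_set_series_stabilizer : group_set series_stabilizer.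
Proof.
have [F1 FM] := group_setP (group_set_AutF F sBS).
apply/group_setP; split=> [|a b /series_stabilizerP[Fa Ea]].
  by apply/series_stabilizerP; split=> // i x _; rewrite perm1 mulVg.
case/series_stabilizerP=> Fb Eb; apply/series_stabilizerP.
split=> [|i x XBx]; first exact: FM.
have -> : x^-1 * (a * b) x = x^-1 * a x * ((a x)^-1 * b (a x)).
  by rewrite permM mulgA mulgK.
by rewrite groupM ?Ea ?Eb // AutF_mem.
Qed.

(** For [y = b^-1 x], the element [x^-1 * (a ^ b) x] equals [b (y^-1 * a y)]. *)
Lemma series_stabilizer_conj a b : a \in series_stabilizer ->
  b \in AutF F B -> a ^ b \in series_stabilizer.
Proof.
case/series_stabilizerP=> Fa Ea Fb.
pose G := Group (group_set_AutF F sBS).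
have Gb : b \in G := Fb; have GbV : b^-1 \in G by rewrite groupV.
have Ga : a \in G := Fa.
apply/series_stabilizerP; split=> [|i x XBx]; first exact: (groupJ Ga Gb).
have XBy : b^-1 x \in B :&: X i by apply: AutF_mem.
move: (Ea _ _ XBy); set y := b^-1 x => Yy.
have [[By Xy] [Ba _]] := (setIP XBy, setIdP Fa).
have [/setIdP[Bb hb]] := (Fb : b \in [set c in Aut B | fhom F B B c]).
have xE : x = b y by rewrite /y permKV.
have Bay := Aut_closed Ba By.
have -> : x^-1 * (a ^ b) x = b (y^-1 * a y).
  rewrite conjgE !permM -/y {1}xE.
  by have := morphM (autm_morphism Bb) (groupVr By) Bay;
     rewrite (morphV (autm_morphism Bb)) //= autmE => ->.
by apply: (strongly_closed_fhom _ hb); rewrite // groupM ?groupV.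
Qed.

End SeriesStabilizer.

End Saturation.

(** * Morphisms on joins with [P] *)

Section JoinClosed.

Variables (gT : finGroupType) (S : {group gT}) (F : fusion_system S).
Variables (P A B : {group gT}) (g : gT -> gT).
Hypothesis clP : strongly_closed F P.
Hypothesis hg : fhom F (P <*> A)%G S g.

Let sPAS : P <*> A \subset S.
Proof. by case: (fhom_obj hg). Qed.

Let sAS : A \subset S.
Proof. exact: subset_trans (joing_subr P A) sPAS. Qed.

Let gP : g @: P = P.
Proof. by apply: strongly_closed_im hg _; rewrite // joing_subl. Qed.

Let norm_P (C : {group gT}) : C \subset S -> C \subset 'N(P).
Proof.
by case/andP: (strongly_closed_normal clP) => _ nPS /subset_trans->.
Qed.

Let gM s x : s \in P -> x \in A -> g (s * x) = g s * g x.
Proof.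
have [gM _ _] := fhom_inj hg => Ps Ax.
apply: gM; first exact: (subsetP (joing_subl P A)).
exact: (subsetP (joing_subr P A)).
Qed.

(** Strong closure gives [g @: P = P], and [P <*> A] consists of products, so the image is
    controlled by that of [A]. *)
Lemma fhom_join :
  g @: A \subset B -> B \subset S -> fhom F (P <*> A)%G (P <*> B)%G g.
Proof.
move=> sgAB sBS; apply: (fhom_codom hg).
  apply/subsetP=> _ /imsetP[y PAy ->].
  move: PAy; rewrite /= norm_joinEr ?norm_P // => /mulsgP[s x Ps Ax ->].
  rewrite gM // groupM //.
    by apply: (subsetP (joing_subl P B)); rewrite -gP imset_f.
  by apply: (subsetP (joing_subr P B)); rewrite (subsetP sgAB) ?imset_f.
by rewrite join_subG sBS; case: clP => ->.
Qed.

Lemma fiso_join :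
  g @: A = B -> B \subset S -> fiso F (P <*> A)%G (P <*> B)%G g.
Proof.
move=> gA sBS; have hPB : fhom F (P <*> A)%G (P <*> B)%G g.
  by apply: fhom_join; rewrite ?gA.
rewrite /fiso hPB eqEsubset; have [_ _ ->] := fhom_inj hPB => /=.
rewrite /= (norm_joinEr (norm_P sBS)); apply/subsetP=> _ /mulsgP[t y + + ->].
rewrite -{1}gP -gA => /imsetP[s Ps ->] /imsetP[x Ax ->].
rewrite -gM // imset_f // groupM //.
  exact: (subsetP (joing_subl P A)).
exact: (subsetP (joing_subr P A)).
Qed.

End JoinClosed.

(** * Extending morphisms by means of the series *)

Section CentralSeries.

Variables (gT : finGroupType) (S : {group gT}) (F : fusion_system S).
Variables (p : nat) (P : {group gT}) (n : nat) (Q : nat -> {group gT}).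
Hypotheses (p_pr : prime p) (pS : p.-group S) (satF : saturated F p).
Hypothesis clP : strongly_closed F P.
Hypotheses (Q0 : Q 0 = 1 :> {set gT}) (Qn : Q n = OhmStar P).
Hypothesis clQ : forall i, i <= n -> strongly_closed F (Q i).
Hypothesis cQP : forall i, i < n -> [~: Q i.+1, P] \subset Q i.
Implicit Types (A B : {group gT}) (f g : gT -> gT).

(** [Some j] is the step from [Q j] to [Q j.+1] and [None] the step from [P] to [S]. The gap from
    [OhmStar P] to [P] is covered by [fix_of_fix_OhmStar]. *)
Let X (i : option 'I_n) : {group gT} := oapp (fun j : 'I_n => Q j.+1) S i.
Let Y (i : option 'I_n) : {group gT} := oapp (fun j : 'I_n => Q j) P i.

Let clX i : strongly_closed F (X i).
Proof. by case: i => [i|] /=; [apply: clQ | apply: strongly_closed_self]. Qed.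

Let clY i : strongly_closed F (Y i).
Proof. by case: i => [i|] //=; apply/clQ/ltnW. Qed.

Let sPS : P \subset S.
Proof. by case: clP. Qed.

Let nPS : S \subset 'N(P).
Proof. by case/andP: (strongly_closed_normal clP). Qed.

(** For any other prime order, [a] fixes each [B :&: Q i] by induction, then [B :&: P] by
    [fix_of_fix_OhmStar], then [B] by the step [None]; so [a] is trivial. *)
Lemma series_stabilizer_prime_order B a : B \subset S ->
  a \in series_stabilizer F X Y B -> prime #[a] -> #[a] = p.
Proof.
move=> sBS /series_stabilizerP[Fa Ea] q_pr; apply/eqP/contraT => neq_qp.
have [Ba ha] := setIdP Fa.
have co : coprime #|B| #[a].
  apply: pnat_coprime (pgroupS sBS pS) _.
  by rewrite pnatE // inE /= inE.
have fix1 x : x \in B -> a (x^-1 * a x) = x^-1 * a x -> a x = x.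
  move=> Bx; have := @coprime_fix_of_fix_quotient _ _ (autm_morphism Ba) _ x co.
  by rewrite /= autmE; apply; rewrite // ?Aut_closed // -permX expg_order perm1.
have fixQ i : i <= n -> {in B :&: Q i, forall x, a x = x}.
  elim: i => [_|i IHi lt_in] x /setIP[Bx Qx].
    by move: Qx; rewrite Q0 => /set1P->; rewrite -(autmE Ba) morph1.
  apply: fix1 => //; apply: IHi; first exact: ltnW.
  rewrite inE groupM ?groupV ?(Aut_closed Ba) //=.
  by apply: (Ea (Some (Ordinal lt_in))); rewrite inE Bx.
have fixP : {in B :&: P, forall x, a x = x}.
  pose f := restrm_morphism (subsetIl B P) (autm_morphism Ba).
  have fE x : f x = a x by rewrite /= autmE.
  have fI : f @* (B :&: P) = B :&: P.
    rewrite morphimEdom; apply/eqP; rewrite eqEcard.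
    rewrite card_in_imset ?leqnn ?andbT; last first.
      by move=> x y _ _; rewrite !fE; apply: perm_inj.
    apply/subsetP=> _ /imsetP[x BPx ->]; rewrite fE.
    exact: AutF_mem Fa clP BPx.
  have coI : coprime #|B :&: P| #[a].
    by apply: coprime_dvdl co; rewrite cardSg ?subsetIl.
  move=> x BPx; rewrite -fE.
  apply: (fix_of_fix_OhmStar p_pr (pgroupS sPS pS) _ _ fI coI) => //.
  - exact: subsetIr.
  - exact: injm_restrm (injm_autm Ba).
  - by move=> y _; rewrite -(eq_iter fE) -permX expg_order perm1.
  move=> y /setIP[/setIP[By _] Oy]; rewrite fE.
  by apply: (fixQ n); rewrite // Qn inE By.
have a1 : a = 1.
  apply: (eq_Aut Ba (group1 _)) => x Bx; rewrite perm1; apply: fix1 => //.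
  apply: fixP; rewrite inE groupM ?groupV ?(Aut_closed Ba) //=.
  by apply: (Ea None); rewrite inE Bx (subsetP sBS).
by rewrite a1 order1 in q_pr.
Qed.

(** A normal p-subgroup lies in every Sylow p-subgroup. *)
Lemma series_stabilizer_sub_AutS B : B \subset S -> fully_automized F p B ->
  series_stabilizer F X Y B \subset AutS S B.
Proof.
move=> sBS autB; pose G := Group (group_set_AutF F sBS).
pose K := Group (group_set_series_stabilizer Y sBS clX).
have sKG : K \subset G by apply/subsetP=> a /series_stabilizerP[].
have pK : p.-group K.
  apply: pgroup_of_prime_order => a; exact: series_stabilizer_prime_order.
have [b Gb sKb] := @Sylow_subJ p _ G (conj_aut B @* 'N_S(B))%G K autB sKG pK.
apply/subsetP=> a Ka; rewrite -(memJ_conjg _ b).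
by apply: (subsetP sKb); apply: series_stabilizer_conj.
Qed.

(** Condition (b) enters here; the step [None] uses that [S] normalizes [P]. *)
Lemma conj_aut_series_stabilizer B s : B \subset S -> s \in 'N_P(B) ->
  conj_aut B s \in series_stabilizer F X Y B.
Proof.
move=> sBS /setIP[Ps Ns].
have NSs : s \in 'N_S(B) by rewrite inE (subsetP sPS).
apply/series_stabilizerP; split=> [|i x /setIP[Bx Xx]].
  exact: conj_aut_AutF.
rewrite norm_conj_autE // -commgEl; case: i Xx => [i|] /= Xx.
  by apply: (subsetP (cQP (ltn_ord i))); rewrite mem_commg.
by rewrite commgEr groupM // memJ_norm ?groupV // (subsetP nPS).
Qed.

(** The extender contains [B] and, by normality of the stabilizer, ['N_P(B)]. In the p-group
    [P <*> B], the proper subgroup [B] is smaller than its normalizer ['N_P(B) * B]. *)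
Lemma extender_proper B a : B \subset S -> ~~ (P \subset B) ->
    fully_automized F p B -> a \in AutF F B ->
  B \proper extender S B B a.
Proof.
move=> sBS nsPB autB Fa; have [Ba ha] := setIdP Fa.
have sBE : B \subset extender S B B a.
  have sBN : B \subset 'N_S(B) by rewrite subsetI sBS normG.
  apply/subsetP=> s Bs; rewrite inE (subsetP sBN) //=.
  apply/exists_inP; exists (a s); first by rewrite (subsetP sBN) ?Aut_closed.
  apply/forall_inP=> x Bx; apply/eqP.
  by have := morphJ (autm_morphism Ba) Bx Bs; rewrite /= autmE.
have sNE : 'N_P(B) \subset extender S B B a.
  apply/subsetP=> s NPs; have [Ps Ns] := setIP NPs.
  rewrite inE inE (subsetP sPS) // Ns /=.
  have Ks := conj_aut_series_stabilizer sBS NPs.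
  have := series_stabilizer_conj sBS clX clY Ks Fa.
  move/(subsetP (series_stabilizer_sub_AutS sBS autB))/morphimP=> [t _ Nt dt].
  apply/exists_inP; exists t => //; apply/forall_inP=> x Bx.
  rewrite -(norm_conj_autE Ns Bx) -permM conjgC dt permM norm_conj_autE //.
    by case/setIP: Nt.
  exact: (Aut_closed Ba).
rewrite properE sBE; apply: contra nsPB => sEB.
have nPB : B \subset 'N(P) := subset_trans sBS nPS.
have sBG : B \subset P <*> B := joing_subr _ _.
apply: contraTT isT => nsPB.
have ltBG : B \proper P <*> B.
  by rewrite properE sBG join_subG subxx andbT.
have nilG : nilpotent (P <*> B).
  by apply: (pgroup_nil (p := p)); apply: pgroupS pS; rewrite join_subG sPS.
have /andP[_ /negP[]] := nilpotent_proper_norm nilG ltBG.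
apply/subsetP=> y /setIP[]; rewrite /= norm_joinEr // => /mulsgP[s b Ps Bb ->].
rewrite (groupMr _ (subsetP (normG B) _ Bb)) => Ns.
by rewrite groupM // (subsetP sEB) // (subsetP sNE) // inE Ps Ns.
Qed.

Section Extension.

Variable m : nat.

(* The case of larger sources, available by downward induction on the order.  *)
Hypothesis extends_of_card_gt : forall A f, m < #|A| -> fhom F A S f ->
  exists2 g, fhom F (P <*> A)%G S g & {in A, g =1 f}.

Lemma extends_of_proper_extends A B f g :
    #|A| = m -> A \proper B -> fhom F B S g -> {in A, g =1 f} ->
  exists2 h, fhom F (P <*> A)%G S h & {in A, h =1 f}.
Proof.
move=> oA ltAB hg gf; have [sAB _] := andP ltAB.
have [|h hh hE] := @extends_of_card_gt B g _ hg.
  by rewrite -oA proper_card.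
exists h; last by move=> x Ax; rewrite hE ?gf // (subsetP sAB).
apply: (fhom_sub hh) => //.
by rewrite join_subG joing_subl (subset_trans sAB) ?joing_subr.
Qed.

Lemma extends_of_sub A f : P \subset A -> fhom F A S f ->
  exists2 g, fhom F (P <*> A)%G S g & {in A, g =1 f}.
Proof.
by move=> sPA hf; exists f; rewrite // (fhom_sub hf) // join_subG sPA /=.
Qed.

Lemma AutF_extends B a :
    #|B| = m -> B \subset S -> fully_normalized F B -> a \in AutF F B ->
  exists2 g, fhom F (P <*> B)%G S g & {in B, g =1 a}.
Proof.
move=> oB sBS nB Fa; have [sat1 sat2] := satF.
have [cB autB] := sat1 B sBS nB; have [_ ha] := setIdP Fa.
have [sPB | nsPB] := boolP (P \subset B).
  by apply: extends_of_sub sPB _; apply: fhom_sub ha _ _ _.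
have [g hg gE] := sat2 _ _ _ (AutF_fiso Fa) cB.
by apply: extends_of_proper_extends oB _ hg gE; apply: extender_proper.
Qed.

(** An automorphism [a] of [B] is chosen so that the extender of [a \o f] contains ['N_S(A)]; the
    extension of [a \o f] is then corrected by one of [a^-1]. *)
Lemma fiso_fully_normalized_extends A B f :
    #|A| = m -> fiso F A B f -> fully_normalized F B ->
  exists2 g, fiso F (P <*> A)%G (P <*> B)%G g & {in A, g =1 f}.
Proof.
move=> oA isof nB; have [sAS sBS] := fiso_sub isof.
have [hf /eqP fA] := andP isof.
suff [g hg gE] : exists2 g, fhom F (P <*> A)%G S g & {in A, g =1 f}.
  exists g => //; apply: fiso_join => //.
  by rewrite (eq_in_imset gE).
have [sPA | nsPA] := boolP (P \subset A).
  by apply: extends_of_sub sPA _; apply: fhom_sub hf _ _ _.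
have [sat1 sat2] := satF; have [cB autB] := sat1 B sBS nB.
have [a Fa sNE] := fully_automized_twist pS isof autB.
have [c hc cE] := sat2 _ _ _ (fiso_comp isof (AutF_fiso Fa)) cB.
have [|d hd dE] := extends_of_proper_extends (f := a \o f) oA _ hc cE.
  apply: proper_sub_trans sNE; apply: nilpotent_proper_norm (pgroup_nil pS) _.
  by rewrite properE sAS; apply: contra nsPA; apply: subset_trans.
have oB : #|B| = m by rewrite (fiso_card isof).
have FaV : a^-1 \in AutF F B.
  have /(groupVr (G := Group (group_set_AutF F sBS))) := Fa.
  exact.
have [b hb bE] := AutF_extends oB sBS nB FaV.
have Baf x : x \in A -> a (f x) \in B.
  case/setIdP: Fa => Ba _ Ax; apply: (Aut_closed Ba).
  by rewrite -fA imset_f.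
exists (b \o d) => [|x Ax]; last by rewrite /= dE //= bE ?Baf // permK.
apply: fhom_comp hb; apply: fhom_join => //.
by apply/subsetP=> _ /imsetP[x Ax ->]; rewrite dE //= Baf.
Qed.

End Extension.

(** The source [A] and the image [C] of [f] both map isomorphically onto a fully normalized [B].
    Both isomorphisms extend to joins with [P], and one extension followed by the inverse of the
    other extends [f]. *)
Lemma strongly_closed_extends A f : fhom F A S f ->
  exists2 g, fhom F (P <*> A)%G S g & {in A, g =1 f}.
Proof.
(* The measure falls as [#|A|] grows, which gives the downward induction. *)
have [m] := ubnP (#|S| - #|A|); elim: m A f => // m IHm A f ltm hf.
have IH A' f' : #|A| < #|A'| -> fhom F A' S f' ->
    exists2 g, fhom F (P <*> A')%G S g & {in A', g =1 f'}.
  move=> ltA hf'; apply: IHm => //; rewrite -ltnS; apply: leq_trans ltm.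
  have [sA'S _] := fhom_obj hf'.
  by rewrite ltnS ltn_sub2l // (leq_trans ltA) ?subset_leq_card.
have [C isof] := fiso_image hf; have [sAS sCS] := fiso_sub isof.
have [B [k isok] nB] := ex_fully_normalized F sCS.
have [g1 isog1 g1E] :=
  fiso_fully_normalized_extends IH erefl (fiso_comp isof isok) nB.
have [g2 isog2 g2E] :=
  fiso_fully_normalized_extends IH (fiso_card isof) isok nB.
have [h /andP[hh _] g2K] := fiso_inv isog2.
have [hg1 _] := andP isog1.
exists (h \o g1) => [|x Ax].
  by apply: fhom_sub (fhom_comp hg1 hh) _ _ _; rewrite // join_subG sPS.
have Cfx : f x \in C by case/andP: isof => _ /eqP <-; rewrite imset_f.
by rewrite /= g1E //= -g2E // g2K // (subsetP (joing_subr P C)).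
Qed.

End CentralSeries.

(** * The two directions of the equivalence *)

Section Normal.

Variables (gT : finGroupType) (S : {group gT}) (F : fusion_system S).
Variable P : {group gT}.

(** A morphism on [<[x]>] extends to one that restricts to an automorphism of [P], and this
    preserves [Q]. *)
Lemma char_strongly_closed (Q : {group gT}) :
  fusion_normal F P -> Q \char P -> strongly_closed F Q.
Proof.
move=> [/andP[sPS _] extP] chQ; have sQP := char_sub chQ.
split=> [|x f Qx hf]; first exact: subset_trans sPS.
have [g [hg gE gP]] := extP _ _ _ hf.
have [gM injg _] := fhom_inj hg.
have sP := subsetP (joing_subl P <[x]>).
pose gP_morph := Morphism (sub_in2 sP gM).
have /charP[_ chQg] := chQ.
have gQ : gP_morph @* Q = Q.
  apply: chQg; last by rewrite morphimEdom.
  by apply/injmP; apply: sub_in2 sP _ injg.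
rewrite -gE ?cycle_id // -gQ.
exact: (mem_morphim gP_morph (subsetP sQP x Qx)).
Qed.

Lemma OhmStar_char : OhmStar P \char P.
Proof. by rewrite /OhmStar; case: ifP => _; apply: Ohm_char. Qed.

End Normal.

Theorem theorem4 (p : nat) (gT : finGroupType) (S : {group gT})
    (F : fusion_system S) (P : {group gT}) :
  prime p -> p.-group S -> saturated F p -> strongly_closed F P ->
  (fusion_normal F P <->
   exists (n : nat) (Q : nat -> {group gT}),
     [/\ (Q 0 = 1 :> {set gT}) /\ Q n = OhmStar P,
         forall i : nat, i < n -> Q i \subset Q i.+1,
         forall i : nat, i <= n -> strongly_closed F (Q i)
       & forall i : nat, i < n -> [~: Q i.+1, P] \subset Q i]).
Proof.
move=> p_pr pS satF clP; have [sPS _] := clP; split=> [nFP | [n [Q]]].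
  have nilP := pgroup_nil (pgroupS sPS pS).
  (* The upper central series reaches [P] at its nilpotency class, so the last term is all of
     [OhmStar P]. *)
  exists (nil_class P), (fun i => ('Z_i(P) :&: OhmStar P)%G).
  split=> [|i _|i _|i _].
  - split; first by rewrite /= ucn0 (setIidPl (sub1G _)).
    apply: val_inj => /=.
    rewrite (ucn_nil_classP _ nilP (leqnn _)).
    exact/setIidPr/char_sub/OhmStar_char.
  - by rewrite setSI // ucn_subS.
  - apply: (char_strongly_closed nFP).
    by rewrite charI ?ucn_char ?OhmStar_char.
  rewrite subsetI (subset_trans (commSg _ (subsetIl _ _)) (ucn_comm i P)) /=.
  rewrite (subset_trans (commSg _ (subsetIr _ _))) // commg_subl.
  exact/char_norm/OhmStar_char.
case=> [[Q0 Qn] _ clQ cQP]; split; first exact: (strongly_closed_normal clP).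
move=> A B f hf; have [sAS sBS] := fhom_obj hf.
(* The codomain is enlarged to [S] to extend [f], and is cut back to [P <*> B] afterwards. *)
have [g hg gE] := strongly_closed_extends p_pr pS satF clP Q0 Qn clQ cQP
  (fhom_sub hf (subxx A) sBS (subxx S)).
exists g; split=> //.
  apply: fhom_join => //; rewrite (eq_in_imset gE).
  by case: (fhom_inj hf).
by apply: strongly_closed_im hg _; rewrite // joing_subl.
Qed.
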